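(* Let $M$ be an integer expanding $d\times d$ matrix. All self-affine attractors generated by $M$ with digit sets forming an arithmetic progression are affinely similar to each other; that is, if $D_1$ and $D_2$ are two admissible digit sets for $M$, each of which forms an arithmetic progression, then $G(M,D_1)$ and $G(M,D_2)$ are affinely similar.
   Context: An integer $d\times d$ matrix $M$ is called expanding if all its (complex) eigenvalues have modulus strictly greater than $1$. Put $m=|\det M|$. An admissible digit set for $M$ is a set $D=\{\boldsymbol d_0,\ldots,\boldsymbol d_{m-1}\}\subset\mathbb{Z}^d$ of $m$ vectors from pairwise different quotient classes of $\mathbb{Z}^d/M\mathbb{Z}^d$, i.e. $\boldsymbol d_i-\boldsymbol d_j\notin M\mathbb{Z}^d$ for $i\neq j$. The self-affine attractor generated by $M$ and $D$ is the compact set $G(M,D)=\{\sum_{k=1}^{\infty}M^{-k}\boldsymbol a_k : \boldsymbol a_k\in D \text{ for all } k\}\subset\mathbb{R}^d$. A digit set forms an arithmetic progression if $D=\{\boldsymbol d_0,\boldsymbol d_0+\boldsymbol q,\ldots,\boldsymbol d_0+(m-1)\boldsymbol q\}$ for some vectors $\boldsymbol d_0,\boldsymbol q$ with $\boldsymbol q\ne\boldsymbol 0$. Two subsets of $\mathbb{R}^d$ are affinely similar if one is the image of the other under an invertible affine map of $\mathbb{R}^d$. *)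

(* Defs.v *)
From HB Require Import structures.
From mathcomp Require Import all_boot all_order all_algebra.
From mathcomp Require Import complex.
From mathcomp Require Import all_classical all_reals all_analysis.
Set Implicit Arguments.
Unset Strict Implicit.
Unset Printing Implicit Defensive.
Import Order.TTheory GRing.Theory Num.Theory.
Import numFieldNormedType.Exports.
Local Open Scope classical_set_scope.
Local Open Scope ring_scope.
Local Open Scope complex_scope.

Definition expanding (R : realType) (d : nat) (M : 'M[int]_d) : Prop :=
  forall a : R[i],
    eigenvalue (map_mx (fun z : int => z%:~R : R[i]) M) a -> 1 < `|a|.

Definition digit_count (d : nat) (M : 'M[int]_d) : nat := absz (\det M).

Definition admissible (d : nat) (M : 'M[int]_d) (D : set 'cV[int]_d) : Prop :=
  (D #= `I_(digit_count M))%card /\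
  forall x y : 'cV[int]_d, D x -> D y -> x <> y ->
    ~ exists z : 'cV[int]_d, x - y = M *m z.

Definition arithmetic_progression (d : nat) (M : 'M[int]_d)
    (D : set 'cV[int]_d) : Prop :=
  exists d0 q : 'cV[int]_d,
    q <> 0 /\ D = [set d0 + q *+ k | k in `I_(digit_count M)].

Definition to_real (R : realType) (m n : nat) (A : 'M[int]_(m, n))
  : 'M[R]_(m, n) := map_mx (fun z : int => z%:~R) A.

(* Digit sequences are indexed from 0, so [a k] carries the factor M^-(k+1).
   Convergence in the matrix topology is entrywise. *)
Definition attractor (R : realType) (d : nat) (M : 'M[int]_d)
    (D : set 'cV[int]_d) : set 'cV[R]_d :=
  [set x | exists a : nat -> 'cV[int]_d,
     (forall k, D (a k)) /\
     (fun n => \sum_(0 <= k < n)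
        (invmx (to_real R M) ^+ k.+1) *m to_real R (a k)) @ \oo --> x].
Arguments attractor R {d} M D.

Definition affinely_similar (R : realType) (d : nat) (X Y : set 'cV[R]_d)
  : Prop :=
  exists (A : 'M[R]_d) (b : 'cV[R]_d),
    A \in unitmx /\ Y = [set A *m x + b | x in X].

(* Main.v *)
(* Let N = M^-1 over R, and let D_i have base point d_i and step q_i.  Expansion
   gives N^n -> 0: by Cayley-Hamilton, peel the eigenvalues off one at a time.
   Admissibility makes q_i generate Z^d / M Z^d, and then q_i is a cyclic vector
   of N: an integer row g with g N^k q_i = 0 for all k takes integer values on
   N^n Z^d, so contraction forces g = 0.  Hence some invertible polynomial A in N
   maps q_1 to q_2, and G(M, D_2) is the image of G(M, D_1) under
   x |-> A x + sum_(k >= 1) N^k (d_2 - A d_1) = A x + (M - 1)^-1 (d_2 - A d_1). *)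

Require Import Defs.
From mathcomp Require Import all_boot all_order all_algebra.
From mathcomp Require Import all_classical all_reals all_analysis.
From mathcomp Require Import complex ring.

Set Implicit Arguments.
Unset Strict Implicit.
Unset Printing Implicit Defensive.
Import Order.TTheory GRing.Theory Num.Theory.
Import numFieldNormedType.Exports.
Local Open Scope classical_set_scope.
Local Open Scope ring_scope.

(** * Convergence of matrices *)

Lemma cvg_mx_coord (R : realType) (m n : nat) (u : nat -> 'M[R]_(m, n))
    (x : 'M[R]_(m, n)) :
  (forall i j, (fun k => u k i j) @ \oo --> x i j) <-> u @ \oo --> x.
Proof.
split=> [ux A [P xP sPA]|ux i j].
  have : \forall k \near \oo, forall i j, P i j (u k i j).
    by apply: filter_forall => i; apply: filter_forall => j; exact: ux (xP i j).
  by apply: filterS => k Pk; apply: sPA.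
apply: (@cvg_comp _ _ _ u (fun M : 'M[R]_(m, n) => M i j) _ _ _ ux).
exact: coord_continuous.
Qed.

Lemma cvg_mulmx (R : realType) (m n p : nat) (u : nat -> 'M[R]_(m, n))
    (v : nat -> 'M[R]_(n, p)) (x : 'M[R]_(m, n)) (y : 'M[R]_(n, p)) :
  u @ \oo --> x -> v @ \oo --> y -> (fun k => u k *m v k) @ \oo --> x *m y.
Proof.
move=> /cvg_mx_coord ux /cvg_mx_coord vy; apply/cvg_mx_coord => i j.
rewrite mxE; under eq_fun do rewrite mxE.
apply: cvg_big => [|l _]; first exact: add_continuous.
by apply: cvgM; [exact: ux|exact: vy].
Qed.

(** * Geometric decay of matrix powers *)

Definition geometric_decay (C : numDomainType) (u : nat -> C) : Prop :=
  exists K r : C, [/\ 0 <= r, r < 1 & forall n, `|u n| <= K * r ^+ n].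

(** The recursion u (n+1) = z u n + error preserves a bound K' s^n as soon as s exceeds both |z| and
    the rate r of the error, and K' is large enough. *)
Lemma geometric_decay_step (C : numFieldType) (z : C) (u : nat -> C) :
  `|z| < 1 -> geometric_decay (fun n => u n.+1 - z * u n) ->
  geometric_decay u.
Proof.
move=> z1 [K [r [r0 r1 uK]]].
have z0 := normr_ge0 z; set l := `|z| in z0 z1.
(* A closed formula for a rate below 1 and above both l and r, with no comparison of l and r. *)
pose s := 1 - (1 - r) * (1 - l) / 2.
have l1' : 0 < 1 - l by rewrite subr_gt0.
have r1' : 0 < 1 - r by rewrite subr_gt0.
have slE : s - l = (1 - l) * (1 + r) / 2 by rewrite /s; field.
have srE : s - r = (1 - r) * (1 + l) / 2 by rewrite /s; field.
have r2 : 0 < 1 + r by rewrite (lt_le_trans ltr01) ?lerDl.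
have l2 : 0 < 1 + l by rewrite (lt_le_trans ltr01) ?lerDl.
have sl : 0 < s - l by rewrite slE divr_gt0 ?mulr_gt0.
have sr : 0 < s - r by rewrite srE divr_gt0 ?mulr_gt0.
have s0 : 0 <= s by rewrite (le_trans z0)// ltW// -subr_gt0.
have s1 : s < 1.
  by rewrite /s ltrBlDr ltrDl divr_gt0 ?mulr_gt0.
have K0 : 0 <= K by have := le_trans (normr_ge0 _) (uK 0%N); rewrite expr0 mulr1.
(* The first summand settles n = 0. The second gives K <= K' (s - l), and K' (s - l) s^n + l K' s^n
   = K' s^(n+1) closes the induction. *)
pose K' := `|u 0%N| + K / (s - l).
have KK' : K <= K' * (s - l).
  by rewrite /K' mulrDl divfK ?gt_eqF// lerDr mulr_ge0// ltW.
exists K', s; split=> //; elim=> [|n IHn].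
  by rewrite expr0 mulr1 /K' lerDl divr_ge0// ltW.
have -> : u n.+1 = (u n.+1 - z * u n) + z * u n by rewrite subrK.
apply: le_trans (ler_normD _ _) _; rewrite normrM.
apply: (@le_trans _ _ (K' * (s - l) * s ^+ n + l * (K' * s ^+ n))).
  apply: lerD; last by rewrite ler_wpM2l.
  apply: le_trans (uK n) _; apply: ler_pM => //; first exact: exprn_ge0.
  by rewrite lerXn2r ?nnegrE// ltW// -subr_gt0.
by rewrite exprS le_eqVlt; apply/orP; left; apply/eqP; ring.
Qed.

Lemma geometric_decay_expmx (C : numClosedFieldType) (n : nat)
    (A : 'M[C]_n.+1) (i j : 'I_n.+1) :
  (forall a, eigenvalue A a -> `|a| < 1) ->
  geometric_decay (fun k => (A ^+ k) i j).
Proof.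
move=> A1.
have [rs] := closed_field_poly_normal (char_poly A).
rewrite (monicP (char_poly_monic A)) scale1r => rsE.
have rs1 z : z \in rs -> `|z| < 1.
  move=> zrs; apply: A1; rewrite eigenvalue_root_char rsE.
  by rewrite root_prod_XsubC.
(* For h the product of (A - w) over w in s, (A - z) h A^k = h A^(k+1) - z h A^k, so
   [geometric_decay_step] removes z from the list. The full list [rs] gives the zero sequence, the
   empty one gives A^k. *)
suff peel : forall s : seq C, {subset s <= rs} ->
    (forall i j, geometric_decay (fun k =>
       (horner_mx A (\prod_(z <- s) ('X - z%:P)) * A ^+ k) i j)) ->
    forall i j, geometric_decay (fun k => (A ^+ k) i j).
  apply: (peel rs) => // i' j'; exists 0, 0; split=> // k.
  by rewrite -rsE [horner_mx _ _]Cayley_Hamilton mul0r mxE normr0 mul0r.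
elim=> [_ H i' j'|z s IHs zs H].
  have [K [r [r0 r1 HK]]] := H i' j'; exists K, r; split=> // k.
  by move: (HK k); rewrite big_nil rmorph1 mul1r.
 apply: IHs => [w ws|i' j']; first by rewrite zs// in_cons ws orbT.
apply: (@geometric_decay_step _ z); first by rewrite rs1// zs// mem_head.
have [K [r [r0 r1 HK]]] := H i' j'; exists K, r; split=> // k.
move: (HK k); rewrite big_cons rmorphM rmorphB /= horner_mx_X horner_mx_C.
set h := horner_mx _ _.
have hA : A * h = h * A by apply: comm_mx_horner.
have zh : z%:M * (h * A ^+ k) = z *: (h * A ^+ k) by exact: mul_scalar_mx.
by rewrite mulrBl mulrBl -!mulrA [A * _]mulrA hA -mulrA -exprS zh !mxE.
Qed.

(** * Expanding matrices and their inverses *)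

(** A nonzero kernel would make a an eigenvalue of M of modulus at most 1. The values a = 0 and a =
    1 give the invertibility of M and of M - 1. *)
Lemma expanding_unitmx_sub (R : realType) (d : nat) (M : 'M[int]_d) (a : R) :
  expanding R M -> `|a| <= 1 -> to_real R M - a%:M \in unitmx.
Proof.
move=> expM a1; rewrite -(map_unitmx (real_complex R)) map_mxB map_scalar_mx /=.
rewrite -row_free_unit -kermx_eq0; apply: contraT => ker0.
have : eigenvalue (map_mx (fun z : int => z%:~R : R[i]) M) a%:C%C.
  congr (kermx _ != 0): ker0; congr (_ - _); apply/matrixP => i j.
  by rewrite !mxE /= rmorph_int.
move=> /expM; rewrite normc_def /= expr0n addr0 sqrtr_sqr ltcR.
by rewrite ltNge a1.
Qed.

Lemma expanding_unitmx (R : realType) (d : nat) (M : 'M[int]_d) :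
  expanding R M -> to_real R M \in unitmx.
Proof.
move=> expM; have := @expanding_unitmx_sub R d M 0 expM.
by rewrite normr0 ler01 raddf0 subr0; apply.
Qed.

Lemma expanding_det_neq0 (R : realType) (d : nat) (M : 'M[int]_d) :
  expanding R M -> \det M != 0.
Proof.
move=> /expanding_unitmx; rewrite unitmxE unitfE det_map_mx.
by apply: contra => /eqP ->; rewrite rmorph0.
Qed.

Lemma geometric_decay_real_complex (R : realType) (u : nat -> R) :
  geometric_decay (fun n => (u n)%:C%C) -> u @ \oo --> (0 : R).
Proof.
move=> [K [r [r0 r1 uK]]].
have K0 : 0 <= K by have := le_trans (normr_ge0 _) (uK 0%N); rewrite expr0 mulr1.
(* In the order of R[i], nonnegative elements are real, so K and r come from R. *)
have realE (x : R[i]) : 0 <= x -> x = (complex.Re x)%:C%C.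
  by case: x => a b; rewrite lecE /= => /andP[/eqP-> _].
move: r0 r1 uK; rewrite (realE _ K0) => r0 r1 uK.
move: r1 uK (r0); rewrite (realE _ r0); move: (complex.Re r) (complex.Re K) => s k.
rewrite ltcR lecR => s1 uk s0.
have {}uk n : `|u n| <= k * s ^+ n.
  by have := uk n; rewrite normc_def /= expr0n addr0 sqrtr_sqr -rmorphXn -rmorphM lecR.
have near_uk : \forall n \near \oo, 0 <= `|u n| <= geometric k s n.
  by apply: nearW => n; rewrite normr_ge0 uk.
have geo0 : geometric k s @ \oo --> (0 : R).
  by apply: cvg_geometric; rewrite ger0_norm.
exact: (norm_cvg0 (squeeze_cvgr near_uk (cvg_cst (0 : R)) geo0)).
Qed.

Lemma cvg_expanding_invX (R : realType) (n : nat) (M : 'M[int]_n.+1) :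
  expanding R M -> (fun k => invmx (to_real R M) ^+ k) @ \oo --> (0 : 'M[R]_n.+1).
Proof.
move=> expM; apply/cvg_mx_coord => i j; rewrite mxE.
set N := invmx _; pose Nc := map_mx (real_complex R) N.
apply: geometric_decay_real_complex.
suff : geometric_decay (fun k => (Nc ^+ k) i j).
  move=> [K [r [r0 r1 NK]]]; exists K, r; split=> // k.
  by move: (NK k); rewrite /Nc -(rmorphXn (map_mx (real_complex R))) mxE.
apply: geometric_decay_expmx => a /eigenvalueP[v vN v0].
pose Mc := map_mx (fun z : int => z%:~R : R[i]) M.
have NcM : Nc *m Mc = 1%:M.
  have -> : Mc = map_mx (real_complex R) (to_real R M).
    by apply/matrixP => p q; rewrite !mxE /= rmorph_int.
  by rewrite -map_mxM mulVmx ?expanding_unitmx// map_mx1.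
(* An eigenvector of the inverse for a is an eigenvector of M for 1/a, and expansion gives |1/a| >
   1. *)
have vE : v = a *: (v *m Mc) by rewrite scalemxAl -vN -mulmxA NcM mulmx1.
have a0 : a != 0 by apply: contraNneq v0 => a0; rewrite vE a0 scale0r.
have /expM : eigenvalue Mc a^-1.
  by apply/eigenvalueP; exists v => //; rewrite {2}vE scalerA mulVf// scale1r.
by rewrite normfV invf_gt1 ?normr_gt0.
Qed.

(** * Residue classes modulo M *)

(** Pigeonhole: with the Smith form M = L diag(a) U, the residues of the entries of L^-1 v modulo
    the a_i determine the class of v. Hence there are at most |det M| classes, and |det M|
    incongruent vectors meet all of them. *)
Lemma modz_class_onto (d : nat) (M : 'M[int]_d) (T : finType)
    (f : T -> 'cV[int]_d) :
  \det M != 0 -> #|T| = digit_count M ->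
  (forall s t, s != t -> ~ exists z, f s - f t = M *m z) ->
  forall v, exists t z, v = f t + M *m z.
Proof.
move=> M0 cardT fdist.
have [L Lu [U Uu [e _ ME]]] := int_Smith_normal_form M.
pose a (i : 'I_d) := e`_i.
have {}ME : M = L *m diag_mx (\row_i a i) *m U.
  rewrite ME; congr (_ *m _ *m _); apply/matrixP => i j.
  by rewrite !mxE val_eqE.
have absunit (A : 'M[int]_d) : A \in unitmx -> `|\det A|%N = 1%N.
  by rewrite unitmxE => /orP[]/eqP->.
have detE : \det M = \det L * (\prod_(i < d) a i) * \det U.
  by rewrite ME !det_mulmx det_diag; under eq_bigr do rewrite mxE.
have a0 (i : 'I_d) : a i != 0.
  by apply: contraNneq M0 => ai; rewrite detE (bigD1 i)//= ai !(mul0r, mulr0).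
have cardE : digit_count M = (\prod_(i < d) `|a i|)%N.
  rewrite /digit_count detE !abszM !absunit// mul1n muln1.
  exact: (big_morph absz abszM (erefl : `|1|%N = 1%N)).
have mod_lt (i : 'I_d) (x : int) : (`|(x %% a i)%Z| < `|a i|)%N.
  by rewrite -ltz_nat gez0_abs ?modz_ge0// ltz_mod.
pose c (v : 'cV[int]_d) i := (invmx L *m v) i 0.
pose X := {dffun forall i : 'I_d, 'I_(`|a i|)}.
pose cls (v : 'cV[int]_d) : X :=
  [ffun i => Ordinal (mod_lt i (c v i))].
have clsP v w : cls v = cls w -> exists z, v - w = M *m z.
  move=> vw.
  have {vw} dv (i : 'I_d) : (a i %| c (v - w) i)%Z.
    have := congr1 (fun g : X => val (g i)) vw; rewrite !ffunE /=.
    move=> /(congr1 Posz); rewrite !gez0_abs ?modz_ge0// => /eqP.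
    by rewrite eqz_mod_dvd /c mulmxBr !mxE.
  exists (invmx U *m (\col_i (c (v - w) i %/ a i)%Z)).
  rewrite ME -!mulmxA (mulKVmx Uu) -[LHS](mulKVmx Lu); congr (L *m _).
  apply/colP => i; rewrite mul_diag_mx !mxE mulrC divzK//.
  by rewrite /c mxE.
have inj : injective (cls \o f).
  by move=> s t /= /clsP st; apply: contraPeq st; exact: fdist.
have cardX : (#|X| <= #|T|)%N.
  rewrite cardT cardE card_dep_ffun foldrE big_image /=.
  by under eq_bigr do rewrite card_ord.
move=> v; have /codomP[t vt] := inj_card_onto inj cardX (cls v).
have [z vz] := clsP _ _ vt; exists t, z; by rewrite -vz addrC subrK.
Qed.

Lemma admissible_progression_span (d : nat) (M : 'M[int]_d)
    (D : set 'cV[int]_d) (d0 q : 'cV[int]_d) :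
  \det M != 0 -> admissible M D -> q <> 0 ->
  D = [set d0 + q *+ k | k in `I_(digit_count M)] ->
  forall v, exists k z, v = q *+ k + M *m z.
Proof.
move=> M0 [_ Ddist] /eqP q0 DE v.
have Dk (k : 'I_(digit_count M)) : D (d0 + q *+ k).
  by rewrite DE; exists k => //=; exact: ltn_ord.
(* Admissibility separates distinct vectors, so distinct indices must first be shown to give
   distinct digits. *)
have inj : injective (fun k => q *+ k).
  have [i qi] : exists i, q i 0 != 0.
    apply/existsP; apply: contraNT q0; rewrite negb_exists => /forallP qi.
    by apply/eqP/colP => i; rewrite mxE; apply/eqP/negbNE/qi.
  move=> k l /(congr1 (fun w : 'cV[int]_d => w i 0)); rewrite !mulmxnE.
  exact: mulrIn.
(* Representing d0 + v rather than v lets the base point cancel. *)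
have [k [z vE]] : exists (k : 'I_(digit_count M)) z,
    d0 + v = d0 + q *+ k + M *m z.
  apply: (@modz_class_onto _ M _ (fun k : 'I_(digit_count M) => d0 + q *+ k)).
  - by [].
  - by rewrite card_ord.
  - move=> s t st; apply: Ddist => //; move/addrI/inj/val_inj/eqP.
    by rewrite (negbTE st).
by exists k, z; apply: (addrI d0); rewrite vE addrA.
Qed.

(** * Krylov matrices and cyclic vectors *)

(** This matrix is invertible exactly when q is a cyclic vector of N. *)
Definition krylov (F : fieldType) (n : nat) (N : 'M[F]_n.+1) (q : 'cV[F]_n.+1) :
    'M[F]_n.+1 :=
  \matrix_(i, j) (N ^+ j *m q) i 0.

Lemma krylov_mulmx (F : fieldType) (n : nat) (N : 'M[F]_n.+1)
    (q c : 'cV[F]_n.+1) :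
  krylov N q *m c = horner_mx N (\poly_(j < n.+1) c (inord j) 0) *m q.
Proof.
rewrite poly_def rmorph_sum mulmx_suml /=; apply/colP => i.
rewrite mxE summxE; apply: eq_bigr => j _.
rewrite mxE linearZ /= rmorphXn /= horner_mx_X inord_val -scalemxAl mxE.
by rewrite mulrC !mxE.
Qed.

Lemma mulmx_krylov (F : fieldType) (n : nat) (A N : 'M[F]_n.+1)
    (q : 'cV[F]_n.+1) :
  comm_mx A N -> A *m krylov N q = krylov N (A *m q).
Proof.
move=> AN; apply/matrixP => i j; rewrite mxE [RHS]mxE.
have ANj : A *m N ^+ j = N ^+ j *m A by exact: commrX.
rewrite mulmxA -ANj -mulmxA mxE.
by apply: eq_bigr => k _; rewrite mxE.
Qed.

Lemma map_krylov (F E : fieldType) (h : {rmorphism F -> E}) (n : nat)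
    (N : 'M[F]_n.+1) (q : 'cV[F]_n.+1) :
  map_mx h (krylov N q) = krylov (map_mx h N) (map_mx h q).
Proof.
apply/matrixP => i j; rewrite [LHS]mxE mxE [RHS]mxE.
by rewrite -(rmorphXn (map_mx h)) -map_mxM [RHS]mxE.
Qed.

(* By Cayley-Hamilton the first n.+1 powers already span all powers. *)
Lemma krylov_annihilator (F : fieldType) (n : nat) (N : 'M[F]_n.+1)
    (q : 'cV[F]_n.+1) (f : 'rV[F]_n.+1) :
  f *m krylov N q = 0 -> forall k, f *m (N ^+ k *m q) = 0.
Proof.
move=> fK k; pose p := 'X^k %% char_poly N.
have -> : N ^+ k = horner_mx N p.
  rewrite -{1}(horner_mx_X N) -rmorphXn /= [in LHS](divp_eq 'X^k (char_poly N)).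
  by rewrite rmorphD rmorphM /= [horner_mx _ (char_poly N)]Cayley_Hamilton mulr0 add0r.
have sp : (size p <= n.+1)%N.
  rewrite -ltnS -[X in (_ < X)%N](size_char_poly N) ltn_modp.
  by rewrite monic_neq0 ?char_poly_monic.
have -> : p = \poly_(j < n.+1) (\col_i p`_i) (inord j : 'I_n.+1) 0.
  apply/polyP => i; rewrite coef_poly mxE; case: ltnP => [lt_in|le_ni].
    by rewrite inordK.
  by rewrite nth_default// (leq_trans sp).
by rewrite -krylov_mulmx mulmxA fK mul0mx.
Qed.

Lemma rat_singular_int_row (n : nat) (A : 'M[rat]_n) :
  A \notin unitmx ->
  exists2 g : 'rV[int]_n, g != 0 & map_mx (intr : int -> rat) g *m A = 0.
Proof.
rewrite -row_free_unit -kermx_eq0 -nz_row_eq0 => f0.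
have /sub_kermxP fA := nz_row_sub (kermx A); move: (nz_row _) f0 fA => f f0 fA.
pose D := \prod_j denq (f 0 j).
(* The kernel row f multiplied by the product D of all its denominators. *)
pose g : 'rV[int]_n := \row_j (numq (f 0 j) * \prod_(k | k != j) denq (f 0 k)).
have gf : map_mx (intr : int -> rat) g = (D%:~R : rat) *: f.
  apply/rowP => j; rewrite !mxE.
  have -> : D = denq (f 0 j) * \prod_(k | k != j) denq (f 0 k) by exact: bigD1.
  by rewrite !intrM numqE; ring.
have D0 : D%:~R != 0 :> rat.
  by rewrite intr_eq0; apply/prodf_neq0 => j _; exact: denq_neq0.
exists g; last by rewrite gf -scalemxAl fA scaler0.
apply: contraNneq f0 => g0; have /esym/eqP := gf.
by rewrite g0 map_mx0 scaler_eq0 (negbTE D0).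
Qed.

(* As g kills q, passing from v = q *+ k + M *m z to M^-1 v keeps the value of
   g integral. *)
Lemma expanding_annihilator_eq0 (R : realType) (n : nat) (M : 'M[int]_n.+1)
    (q : 'cV[int]_n.+1) (g : 'rV[int]_n.+1) :
  expanding R M -> (forall v, exists k z, v = q *+ k + M *m z) ->
  (forall k, to_real R g *m (invmx (to_real R M) ^+ k *m to_real R q) = 0) ->
  g = 0.
Proof.
move=> expM span; set N := invmx _ => gq.
have Mu := expanding_unitmx expM.
have Nu : N \in unitmx by rewrite unitmx_inv.
have g_int k v : exists z : 'M[int]_1,
    to_real R g *m (N ^+ k *m to_real R v) = to_real R z.
  elim: k v => [|k IHk] v.
    by exists (g *m v); rewrite expr0 mul1mx /to_real map_mxM.
  have [l [z ->]] := span v; have [w zw] := IHk z; exists w.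
  rewrite -zw /to_real map_mxD map_mxM raddfMn /= -!/(to_real R _).
  rewrite mulmxDr mulmxDr -scaler_nat -!scalemxAr gq scaler0 add0r.
  rewrite exprSr -[N ^+ k * N]/(N ^+ k *m N) -mulmxA.
  by rewrite [N *m (_ *m _)]mulmxA mulVmx// mul1mx.
have g_int0 k j : exists z : int, (to_real R g *m N ^+ k) 0 j = z%:~R.
  have [z] := g_int k (delta_mx j 0); rewrite mulmxA /to_real map_delta_mx -colE.
  by move=> /matrixP/(_ 0 0); rewrite mxE [RHS]mxE => ->; exists (z 0 0).
have gN0 j : (fun k => (to_real R g *m N ^+ k) 0 j) @ \oo --> (0 : R).
  have -> : 0 = (to_real R g *m (0 : 'M[R]_n.+1)) 0 j by rewrite mulmx0 mxE.
  apply: (cvg_mx_coord (fun k => to_real R g *m N ^+ k) _).2.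
  by apply: cvg_mulmx; [exact: cvg_cst|exact: cvg_expanding_invX].
have ev : \forall k \near \oo, forall j, (to_real R g *m N ^+ k) 0 j = 0.
  (* Integers tending to 0 are eventually 0. So g N^k = 0 for some k, and N^k is invertible. *)
  apply: filter_forall => j.
  have small : \forall k \near \oo, `|(to_real R g *m N ^+ k) 0 j| < 1.
    exact: cvgr0_norm_lt (gN0 j) _ ltr01.
  apply: filterS small => k; have [z ->] := g_int0 k j.
  by rewrite -intr_norm -[1]/(1%:~R) ltr_int; case: z => [[|?]|?].
have [k _ /(_ k (leqnn k)) gNk] := ev.
have Nk : N ^+ k \in unitmx by exact: unitrX.
have g0 : to_real R g = 0.
  rewrite -[LHS](mulmxK Nk); have -> : to_real R g *m N ^+ k = 0 by apply/rowP => j; rewrite gNk mxE.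
  by rewrite mul0mx.
apply/rowP => j; move: g0 => /rowP/(_ j); rewrite !mxE => /eqP.
by rewrite intr_eq0 => /eqP.
Qed.

(** The Krylov matrix has rational entries, so its singularity can be tested over the rationals,
    where it yields the integer row that [expanding_annihilator_eq0] excludes. *)
Lemma krylov_unitmx (R : realType) (n : nat) (M : 'M[int]_n.+1)
    (q : 'cV[int]_n.+1) :
  expanding R M -> (forall v, exists k z, v = q *+ k + M *m z) ->
  krylov (invmx (to_real R M)) (to_real R q) \in unitmx.
Proof.
move=> expM span.
have ratrE (m p : nat) (A : 'M[int]_(m, p)) :
    map_mx (ratr : rat -> R) (map_mx (intr : int -> rat) A) = to_real R A.
  by apply/matrixP => i j; rewrite !mxE ratr_int.
rewrite -!ratrE -map_invmx -map_krylov map_unitmx.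
set K := krylov _ _; apply: contraT => /rat_singular_int_row[g g0 gK].
case/eqP: g0; apply: (@expanding_annihilator_eq0 R n M q) => // k.
have := krylov_annihilator gK k => /(congr1 (map_mx (ratr : rat -> R))).
rewrite !map_mxM map_mx0 !ratrE => <-.
by rewrite (rmorphXn (map_mx _)) /= map_invmx ratrE.
Qed.

(** Cyclicity of q1 writes q2 as A q1 with A a polynomial in N. Then A times the Krylov matrix of q1
    is that of q2, so A is invertible. *)
Lemma krylov_conjugation (R : fieldType) (n : nat) (N : 'M[R]_n.+1)
    (q1 q2 : 'cV[R]_n.+1) :
  krylov N q1 \in unitmx -> krylov N q2 \in unitmx ->
  exists A : 'M[R]_n.+1, [/\ A \in unitmx, comm_mx A N & A *m q1 = q2].
Proof.
move=> K1 K2; pose c := invmx (krylov N q1) *m q2.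
pose A := horner_mx N (\poly_(j < n.+1) c (inord j) 0).
have Aq : A *m q1 = q2 by rewrite -krylov_mulmx mulKVmx.
have AN : comm_mx A N by exact: comm_horner_mx.
exists A; split=> //.
by move: K2; rewrite -Aq -mulmx_krylov// unitmx_mul => /andP[].
Qed.

(** * The affine map between the attractors *)

(** Each digit d1 + l q1 is replaced by d2 + l q2 with the same l. Since A commutes with N, the
    partial sums are mapped by A up to a correction that telescopes. *)
Lemma attractor_image (R : realType) (n : nat) (M : 'M[int]_n.+1)
    (A : 'M[R]_n.+1) (d1 d2 q1 q2 : 'cV[int]_n.+1) (I : set nat) :
  expanding R M -> comm_mx A (invmx (to_real R M)) ->
  A *m to_real R q1 = to_real R q2 ->
  forall x, attractor R M [set d1 + q1 *+ k | k in I] x ->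
  attractor R M [set d2 + q2 *+ k | k in I]
    (A *m x + invmx (to_real R M - 1%:M) *m (to_real R d2 - A *m to_real R d1)).
Proof.
move=> expM AN Aq x [a [aD ax]]; set N := invmx _ in AN ax.
have Mu := expanding_unitmx expM.
have M1u : to_real R M - 1%:M \in unitmx.
  by apply: expanding_unitmx_sub => //; rewrite normr1.
set w := invmx _ *m _.
have /choice[c cP] : forall k, exists l, I l /\ d1 + q1 *+ l = a k.
  by move=> k; have [l Il la] := aD k; exists l.
exists (fun k => d2 + q2 *+ c k); split.
  by move=> k; exists (c k) => //; case: (cP k).
have to_realDM (d q : 'cV[int]_n.+1) k :
    to_real R (d + q *+ k) = to_real R d + to_real R q *+ k.
  by rewrite /to_real map_mxD raddfMn.
have ANk k : A *m N ^+ k = N ^+ k *m A by exact: commrX.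
(* With w = (M - 1)^-1 (d2 - A d1), the shift N^(k+1) (d2 - A d1) equals N^k w - N^(k+1) w. The sum
   of the shifts is w - N^m w, which tends to w. *)
have term k : N ^+ k.+1 *m to_real R (d2 + q2 *+ c k) =
    A *m (N ^+ k.+1 *m to_real R (a k)) + (N ^+ k *m w - N ^+ k.+1 *m w).
  have NkE : N ^+ k = N ^+ k.+1 *m to_real R M.
    by rewrite exprSr -[N ^+ k * N]/(N ^+ k *m N) -mulmxA mulVmx// mulmx1.
  rewrite NkE -mulmxA -mulmxBr -{2}[w]mul1mx -mulmxBl /w mulKVmx//.
  rewrite mulmxA ANk -mulmxA -mulmxDr; congr (_ *m _).
  have [_ <-] := cP k.
  rewrite !to_realDM mulmxDr -Aq -[in RHS]scaler_nat -scalemxAr scaler_nat.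
  by rewrite [RHS]addrC addrA subrK.
have sumE m : \sum_(0 <= k < m) N ^+ k.+1 *m to_real R (d2 + q2 *+ c k) =
    A *m (\sum_(0 <= k < m) N ^+ k.+1 *m to_real R (a k)) + (w - N ^+ m *m w).
  elim: m => [|m IHm].
    by rewrite !big_nil mulmx0 expr0 mul1mx subrr addr0.
  rewrite !big_nat_recr //= IHm term mulmxDr addrACA; congr (_ + _).
  by rewrite addrA subrK.
under eq_fun do rewrite sumE.
apply: cvgD; first by apply: cvg_mulmx => //; exact: cvg_cst.
rewrite -[X in _ --> X]subr0 -(mul0mx _ w).
apply: cvgB; first exact: cvg_cst.
by apply: cvg_mulmx; [exact: cvg_expanding_invX|exact: cvg_cst].
Qed.

Theorem theorem2 (R : realType) (d : nat) (M : 'M[int]_d)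
    (D1 D2 : set 'cV[int]_d) :
  expanding R M ->
  admissible M D1 -> arithmetic_progression M D1 ->
  admissible M D2 -> arithmetic_progression M D2 ->
  affinely_similar (attractor R M D1) (attractor R M D2).
Proof.
move=> expM adm1 [d1 [q1 [q10 D1E]]] adm2 [d2 [q2 [q20 D2E]]].
case: d M D1 D2 expM adm1 d1 q1 q10 D1E adm2 d2 q2 q20 D2E => [|n] M D1 D2 expM.
  (* In dimension 0 no step q1 is nonzero. *)
  by move=> _ _ q1 []; apply/colP; case.
move=> adm1 d1 q1 q10 D1E adm2 d2 q2 q20 D2E.
have M0 := expanding_det_neq0 expM.
have K1 := krylov_unitmx expM (admissible_progression_span M0 adm1 q10 D1E).
have K2 := krylov_unitmx expM (admissible_progression_span M0 adm2 q20 D2E).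
have [A [Au AN Aq]] := krylov_conjugation K1 K2.
pose P := invmx (to_real R M - 1%:M).
pose w := P *m (to_real R d2 - A *m to_real R d1).
exists A, w; split=> //; rewrite {}D1E {}D2E; apply/seteqP.
split=> [y Yy|_ [x Xx <-]].
  (* The reverse inclusion applies [attractor_image] to A^-1 with the two progressions exchanged.
     The point obtained is a preimage of y because A commutes with P. *)
  have A'N : comm_mx (invmx A) (invmx (to_real R M)).
    by apply: commr_sym; apply: commrV; exact: commr_sym.
  have A'q : invmx A *m to_real R q2 = to_real R q1 by rewrite -Aq mulKmx.
  have := @attractor_image _ _ _ _ d2 d1 q2 q1 _ expM A'N A'q _ Yy.
  set x := (X in attractor _ _ _ X -> _) => Xx; exists x => //.
  have Mu := expanding_unitmx expM.
  have AM : comm_mx A (to_real R M).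
    by rewrite -[to_real R M]invmxK; exact: commrV.
  have AP : A *m P = P *m A.
    by apply: commrV; apply: commrB => //; exact: commr1.
  rewrite /x mulmxDr mulKVmx// -addrA mulmxA AP -mulmxA -mulmxDr.
  by rewrite mulmxBr mulKVmx// addrA subrK subrr mulmx0 addr0.
exact: (@attractor_image _ _ _ _ d1 d2 q1 q2 _ expM AN Aq _ Xx).
Qed.
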